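(* For any $r>1$ there is a constant $C(r)$, depending only on $r$, such that for every entire analytic function $f$, every $k\in\mathbb{Z}_+$ and every $z\in\mathbb{C}$, $$|f^{(k)}(z)|^2\le (k!)^2\,C(r)\,e^{|z|^2}(1+|z|)^{2k}\int_{B(z,r)}\big|f(\zeta)e^{-|\zeta|^2/2}\big|^2\,dV(\zeta).$$
   Context: $B(z,r)$ is the disk in $\mathbb{C}$ of radius $r$ centered at $z$, $dV$ is Lebesgue measure on $\mathbb{C}=\mathbb{R}^2$, and $\mathbb{Z}_+=\{0,1,2,\dots\}$. *)

(* Defs.v *)
From HB Require Import structures.
From mathcomp Require Import all_boot all_order all_algebra.
From mathcomp Require Import all_classical all_reals all_analysis.
From mathcomp Require Import complex.

Set Implicit Arguments.
Unset Strict Implicit.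
Unset Printing Implicit Defensive.

Import Order.TTheory GRing.Theory Num.Theory.
Import numFieldNormedType.Exports.

Local Open Scope classical_set_scope.
Local Open Scope ring_scope.
Local Open Scope complex_scope.

(* Naming C as a numFieldType lets the generic topology and normed-module
   structure of a numFieldType (over itself) apply, so that [derivable] and
   [derive1n] on functions C -> C are complex differentiation. *)
Definition Cfield (R : realType) : numFieldType := R[i].

(* The norm [`|z|] of R[i] takes values in R[i]; this one is real-valued. *)
Definition modulus (R : realType) (z : Cfield R) : R := Normc.normc z.

Definition entire (R : realType) (f : Cfield R -> Cfield R) : Prop :=
  forall z : Cfield R, derivable f z 1.

Definition of_plane (R : realType) (p : R * R) : Cfield R := p.1 +i* p.2.

Definition disk (R : realType) (z : Cfield R) (r : R) : set (R * R) :=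
  [set p | modulus (of_plane p - z) < r].

(* Integral over the disk B(z, r) with respect to Lebesgue measure on
   C = R^2; it takes values in the extended reals. *)
Definition disk_integral (R : realType) (z : Cfield R) (r : R)
    (g : Cfield R -> R) : \bar R :=
  (\int[(@lebesgue_measure R) \x (@lebesgue_measure R)]_(p in disk z r)
    (g (of_plane p))%:E)%E.

(* Main.v *)
Require Import Defs.
From mathcomp Require Import all_boot all_order all_algebra.
From mathcomp Require Import all_classical all_reals all_analysis.
From mathcomp Require Import complex ring lra.

Set Implicit Arguments.
Unset Strict Implicit.
Unset Printing Implicit Defensive.

Import Order.TTheory GRing.Theory Num.Theory.
Import numFieldNormedType.Exports.

Local Open Scope classical_set_scope.
Local Open Scope ring_scope.
Local Open Scope complex_scope.

(** With [s := 1 / (1 + |z|) <= 1], Cauchy's estimate on the circle of centre [z] and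
    radius [s] bounds the [k]-th derivative by [k! (1 + |z|)^k] times the maximum of
    [|f|] on that circle ([cauchy_estimate]). At a point [w] of the circle
    [|w|^2 <= |z|^2 + 3], and [|f w|^2 exp (- |w|^2)] is at most a constant times the
    integral of the same density over the disk of radius [r - 1] around [w], which lies
    in the disk of radius [r] around [z] ([gauss_density_le_integral]).

    The local bound. Since
    [|zeta|^2 = 2 Re (w^* zeta) - |w|^2 + |zeta - w|^2], multiplying [f] by
    [exp (- w^* zeta)] turns the Gaussian density into the squared modulus of an entire
    function [g], up to factors that are bounded on the disk, uniformly in [w]. For [g]
    a maximum argument takes the place of the mean value property over the disk, so
    that polar coordinates do not enter: nearly maximise [|g|] times the distance to
    the boundary of the disk. At such a point [z0], at distance [d] from the boundary,
    [|g|] is at most [4 |g z0|] on the disk of radius [d / 2] around [z0], so its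
    derivative is at most a multiple of [|g z0| / d] nearby, and [|g| >= |g z0| / 2] on a
    square of side comparable to [d] ([slow_variation_point]). The integral over this
    square is then at least a multiple of [d^2 |g z0|^2], hence of [|g w|^2].

    Function theory from complex differentiability alone. Goursat's theorem on
    rectangles, by bisection, gives every entire function a primitive
    ([primitive_exists]). Circles are reached through the exponential: [F w] equal to
    [f (z + exp w) exp (- n w)] is entire with period [2 pi i], and if [G] is a primitive
    of [F], the mean of [F] over a period on a vertical line is
    [(G (w + 2 pi i) - G w) / (2 pi i)], which is the same for all [w] because its
    derivative vanishes. So a circle mean is a difference of values of a primitive
    ([mean]); it is independent of the radius, it is bounded by the maximum of [|F|] on
    any vertical line ([mean_le]), and integrating by parts means that derivatives of
    periodic functions have mean zero ([mean_by_parts]). Letting the radius tend to [0]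
    identifies the mean for [n = 1] as [f' z] ([mean_first_derivative]). Applied to
    difference quotients, that formula shows that [f'] is again differentiable
    ([derivative_differentiable]), after which parts and induction give the mean for all
    [n] as the [n]-th derivative divided by [n!] ([mean_derivatives]). *)

(** * The modulus *)

Section ModulusTheory.
Context (R : realType).
Implicit Types (z w : Cfield R) (x y : R).

Lemma modulus_ge0 z : 0 <= modulus z.
Proof. by case: z => a b; rewrite /modulus /= sqrtr_ge0. Qed.

Lemma modulus0 : modulus (0 : Cfield R) = 0.
Proof. exact: Normc.normc0. Qed.

Lemma modulus1 : modulus (1 : Cfield R) = 1.
Proof. exact: Normc.normc1. Qed.

Lemma modulusM z w : modulus (z * w) = modulus z * modulus w.
Proof. exact: Normc.normcM. Qed.

Lemma modulusX z n : modulus (z ^+ n) = modulus z ^+ n.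
Proof. by elim: n => [|n IH]; rewrite ?expr0 ?modulus1 // !exprS modulusM IH. Qed.

Lemma modulusD z w : modulus (z + w) <= modulus z + modulus w.
Proof. exact: le_normcD. Qed.

Lemma modulusN z : modulus (- z) = modulus z.
Proof. exact: normcN. Qed.

Lemma modulusB z w : modulus (z - w) <= modulus z + modulus w.
Proof. by rewrite -(modulusN w) modulusD. Qed.

Lemma modulusBC z w : modulus (z - w) = modulus (w - z).
Proof. by rewrite -opprB modulusN. Qed.

Lemma modulus_eq0 z : modulus z = 0 -> z = 0.
Proof. exact: Normc.eq0_normc. Qed.

Lemma modulus_gt0 z : z != 0 -> 0 < modulus z.
Proof.
move=> z0; rewrite lt_neqAle modulus_ge0 andbT eq_sym.
by apply: contra z0 => /eqP/modulus_eq0 ->.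
Qed.

Lemma modulusC x : modulus (x%:C : Cfield R) = `|x|.
Proof. by rewrite /modulus /= expr0n addr0 sqrtr_sqr. Qed.

Lemma modulusi : modulus ('i%C : Cfield R) = 1.
Proof. by rewrite /modulus /= expr0n add0r expr1n sqrtr1. Qed.

Lemma sqr_modulus z : modulus z ^+ 2 = complex.Re z ^+ 2 + complex.Im z ^+ 2.
Proof. by case: z => a b; rewrite /modulus /= sqr_sqrtr // addr_ge0 // sqr_ge0. Qed.

Lemma Re_le_modulus z : `|complex.Re z| <= modulus z.
Proof.
case: z => a b; rewrite /modulus /= -sqrtr_sqr ler_sqrt ?addr_ge0 ?sqr_ge0 //.
by rewrite lerDl sqr_ge0.
Qed.

Lemma Im_le_modulus z : `|complex.Im z| <= modulus z.
Proof.
case: z => a b; rewrite /modulus /= -sqrtr_sqr ler_sqrt ?addr_ge0 ?sqr_ge0 //.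
by rewrite lerDr sqr_ge0.
Qed.

Lemma of_planeE x y : of_plane (x, y) = x%:C + 'i%C * y%:C :> Cfield R.
Proof. by rewrite [LHS]complexE. Qed.

Lemma ReIm_of_plane z : z = of_plane (complex.Re z, complex.Im z).
Proof. by case: z. Qed.

Lemma modulus_of_plane x y : modulus (of_plane (x, y)) <= `|x| + `|y|.
Proof.
by rewrite of_planeE (le_trans (modulusD _ _)) // modulusM modulusi mul1r !modulusC.
Qed.

Lemma normE z : `|z| = (modulus z)%:C.
Proof. by case: z. Qed.

End ModulusTheory.

(** * Differentiation with real-valued error bounds *)

(** The norm of the complex numbers is complex-valued; stating derivatives with the
    real-valued modulus keeps every error bound in [R]. *)
Definition cder (R : realType) (f : Cfield R -> Cfield R) z d :=
  forall e : R, 0 < e -> exists2 r : R, 0 < r &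
    forall h, modulus h < r -> modulus (f (z + h) - f z - h * d) <= e * modulus h.

(** Stated like [cder] but with real increments, so that passing from a function to its
    restriction to a line ([rder_line]) is only a change of scale. *)
Definition rder (R : realType) (c : R -> Cfield R) t d :=
  forall e : R, 0 < e -> exists2 r : R, 0 < r &
    forall h, `|h| < r -> modulus (c (t + h) - c t - h%:C * d) <= e * `|h|.

(** The error-bound form of differentiability agrees with the limit of difference
    quotients, over [R] as well as over the complex numbers. *)
Lemma growth_rate_cvgP (K : numFieldType) (f : K -> K) (x d : K) :
  (forall e : K, 0 < e -> exists2 r : K, 0 < r &
    forall h, `|h| < r -> `|f (x + h) - f x - h * d| <= e * `|h|) <->
  h^-1 *: (f (h *: 1 + x) - f x) @[h --> 0^'] --> d.
Proof.
have key h e : h != 0 -> (`|d - h^-1 *: (f (h *: 1 + x) - f x)| <= e) =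
    (`|f (x + h) - f x - h * d| <= e * `|h|).
  move=> h0; rewrite -ler_pdivrMr ?normr_gt0 // -normf_div distrC.
  by congr (`|_| <= _); rewrite /GRing.scale /= mulr1 [h + x]addrC; field.
split=> [H|/cvgrPdist_le H].
  apply/cvgrPdist_le => e e0; have [r r0 Hr] := H e e0.
  apply/nbhs_ballP; exists r => //= h hr h0.
  by rewrite key // Hr //; move: hr; rewrite /ball /= sub0r normrN.
move=> e /H; move=> /nbhs_ballP[r /= r0 Hr]; exists r => // h hr.
have [->|h0] := eqVneq h 0.
  by rewrite addr0 subrr mul0r subr0 normr0 mulr0.
by rewrite -key //; apply: Hr => //; rewrite /ball /= sub0r normrN.
Qed.

Section ComplexDerivative.
Context (R : realType).
Implicit Types (f g : Cfield R -> Cfield R) (z d : Cfield R).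

Lemma cder_cvgP f z d :
  cder f z d <-> h^-1 *: (f (h *: 1 + z) - f z) @[h --> 0^'] --> d.
Proof.
split=> [H|/growth_rate_cvgP H].
  apply/growth_rate_cvgP => e; rewrite ltcE => /= /andP[/eqP e1 e0].
  have [r r0 Hr] := H _ e0; exists r%:C; first by rewrite ltcR.
  move=> h; rewrite !normE ltcR => /Hr.
  by case: e e0 e1 Hr => e0 e1 /= _ -> _; rewrite complexr0 -rmorphM lecR.
move=> e e0; have /H[r] : 0 < e%:C :> Cfield R by rewrite ltcR.
rewrite ltcE => /= /andP[/eqP r1 r0] Hr; exists (complex.Re r) => // h hr.
have /Hr : `|h| < r.
  by case: r r1 r0 hr {Hr} => r0 r1 /= -> _ ; rewrite complexr0 normE ltcR.
by rewrite !normE -rmorphM lecR.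
Qed.

Lemma cder_is_derive f z d : cder f z d <-> is_derive z 1 f d.
Proof.
split=> [/cder_cvgP H|[H1 H2]]; last first.
  by apply/cder_cvgP; rewrite -H2; exact: H1.
apply: DeriveDef; first by apply/cvg_ex; exists d.
exact: cvg_lim.
Qed.

Lemma cder_derive1 f z d : cder f z d -> f^`()%classic z = d.
Proof. by move=> /cder_is_derive H; rewrite derive1E derive_val. Qed.

Lemma derivable_cder f z : derivable f z 1 -> cder f z (f^`()%classic z).
Proof. by move=> H; apply/cder_is_derive; rewrite derive1E; exact: derivableP. Qed.

Lemma cder_ext f g z d : f =1 g -> cder f z d -> cder g z d.
Proof. by move=> /funext ->. Qed.

Lemma cder_cst a z : cder (fun=> a) z 0.
Proof. by apply/cder_is_derive; exact: is_derive_cst. Qed.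

Lemma cder_id z : cder id z 1.
Proof. by apply/cder_is_derive; exact: is_derive_id. Qed.

Lemma cderD f g z d d' : cder f z d -> cder g z d' ->
  cder (fun w => f w + g w) z (d + d').
Proof.
by move=> /cder_is_derive H /cder_is_derive H'; apply/cder_is_derive; exact: is_deriveD.
Qed.

Lemma cderM f g z d d' : cder f z d -> cder g z d' ->
  cder (fun w => f w * g w) z (d * g z + f z * d').
Proof.
move=> /cder_is_derive H /cder_is_derive H'; apply/cder_is_derive.
apply: is_derive_eq; rewrite /GRing.scale /=; ring.
Qed.

Lemma cderZ a f z d : cder f z d -> cder (fun w => a * f w) z (a * d).
Proof. by move=> H; have := cderM (cder_cst a z) H; rewrite mul0r add0r. Qed.

Lemma cderB f g z d d' : cder f z d -> cder g z d' ->
  cder (fun w => f w - g w) z (d - d').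
Proof.
move=> H /(cderZ (-1)) H'; have := cderD H H'.
by rewrite mulN1r; apply: cder_ext => w; rewrite mulN1r.
Qed.

Lemma cder_continuous f z d : cder f z d -> forall e : R, 0 < e ->
  exists2 r : R, 0 < r & forall h, modulus h < r -> modulus (f (z + h) - f z) <= e.
Proof.
move=> H e e0; have [r r0 Hr] := H 1 ltr01.
have K0 : 0 < 1 + modulus d by rewrite ltr_pwDl // modulus_ge0.
exists (Num.min r (e / (1 + modulus d))); first by rewrite lt_min r0 divr_gt0.
move=> h; rewrite lt_min => /andP[/Hr h1 h2].
have -> : f (z + h) - f z = (f (z + h) - f z - h * d) + h * d by ring.
rewrite (le_trans (modulusD _ _)) // modulusM.
rewrite (le_trans (lerD h1 (lexx _))) // -mulrC -mulrDr mulrC.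
by rewrite mulrC -ler_pdivlMr // ltW.
Qed.

Lemma cder_comp f g z d d' : cder g z d' -> cder f (g z) d ->
  cder (f \o g) z (d * d').
Proof.
move=> Hg Hf e e0.
have D0 : 0 < 1 + modulus d by rewrite ltr_pwDl // modulus_ge0.
have D'0 : 0 < 1 + modulus d' by rewrite ltr_pwDl // modulus_ge0.
have e1 : 0 < e / 2 / (1 + modulus d') by rewrite !divr_gt0.
have e2 : 0 < Num.min 1 (e / 2 / (1 + modulus d)) by rewrite lt_min ltr01 !divr_gt0.
have [r1 r10 H1] := Hf _ e1; have [r2 r20 H2] := Hg _ e2.
exists (Num.min r2 (r1 / (1 + modulus d'))); first by rewrite lt_min r20 divr_gt0.
move=> h; rewrite lt_min => /andP[/H2 h2 hr].
pose k := g (z + h) - g z.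
have -> : (f \o g) (z + h) - (f \o g) z - h * (d * d') =
    (f (g z + k) - f (g z) - k * d) + (k - h * d') * d.
  by rewrite /k /= [g z + _]addrC subrK; ring.
have hk : modulus k <= (1 + modulus d') * modulus h.
  have -> : k = (k - h * d') + h * d' by ring.
  rewrite (le_trans (modulusD _ _)) // modulusM mulrDl mul1r [_ * modulus d']mulrC.
  rewrite lerD2r (le_trans h2) // ler_piMl ?modulus_ge0 //.
  by rewrite ge_min lexx.
have /H1 h1 : modulus k < r1.
  by rewrite (le_lt_trans hk) // mulrC -ltr_pdivlMr.
rewrite (le_trans (modulusD _ _)) // modulusM (_ : e = e / 2 + e / 2); last by field.
rewrite [leRHS]mulrDl lerD //.
  rewrite (le_trans h1) // (le_trans (ler_wpM2l (ltW e1) hk)) // mulrA divfK //.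
  by rewrite gt_eqF.
rewrite (le_trans (ler_wpM2r (modulus_ge0 _) h2)) //.
have h3 : Num.min 1 (e / 2 / (1 + modulus d)) * (1 + modulus d) <= e / 2.
  by rewrite -ler_pdivlMr // ge_min lexx orbT.
rewrite mulrAC ler_wpM2r ?modulus_ge0 // (le_trans _ h3) //.
by rewrite ler_wpM2l ?(ltW e2) // lerDr.
Qed.

End ComplexDerivative.

(** * Curves: the mean value inequality and primitives *)

Section Curves.
Context (R : realType).
Implicit Types (c : R -> Cfield R) (t : R) (v d : Cfield R).

Lemma rder_line F v p t d : cder F (p + t%:C * v) d ->
  rder (fun s : R => F (p + s%:C * v)) t (d * v).
Proof.
move=> HF e e0.
have V0 : 0 < 1 + modulus v by rewrite ltr_pwDl // modulus_ge0.
have [r r0 Hr] := HF _ (divr_gt0 e0 V0).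
exists (r / (1 + modulus v)); first by rewrite divr_gt0.
move=> h; rewrite ltr_pdivlMr // => hr.
have hv : modulus (h%:C * v) <= `|h| * (1 + modulus v).
  by rewrite modulusM modulusC ler_wpM2l // lerDr.
have := Hr _ (le_lt_trans hv hr).
rewrite [p + (t + h)%:C * v](_ : _ = p + t%:C * v + h%:C * v); last first.
  by rewrite rmorphD /=; ring.
have -> : h%:C * v * d = h%:C * (d * v) by ring.
move=> /le_trans; apply.
rewrite (le_trans (ler_wpM2l _ hv)) ?divr_ge0 ?(ltW e0) ?(ltW V0) //.
by rewrite mulrCA divfK ?gt_eqF // mulrC.
Qed.

Lemma rderD c c' t d d' : rder c t d -> rder c' t d' ->
  rder (fun s => c s + c' s) t (d + d').
Proof.
move=> H H' e e0; have e2 : 0 < e / 2 by rewrite divr_gt0.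
have [r r0 Hr] := H _ e2; have [r' r0' Hr'] := H' _ e2.
exists (Num.min r r'); first by rewrite lt_min r0.
move=> h; rewrite lt_min => /andP[/Hr h1 /Hr' h2].
rewrite (_ : _ - _ - _ = (c (t + h) - c t - h%:C * d) +
  (c' (t + h) - c' t - h%:C * d')); last by ring.
by rewrite (le_trans (modulusD _ _)) // (le_trans (lerD h1 h2)) // -mulrDl -splitr.
Qed.

Lemma rderZ a c t d : rder c t d -> rder (fun s => a * c s) t (a * d).
Proof.
move=> H e e0; have A0 : 0 < 1 + modulus a by rewrite ltr_pwDl // modulus_ge0.
have [r r0 Hr] := H _ (divr_gt0 e0 A0); exists r => // h /Hr h1.
rewrite (_ : _ - _ - _ = a * (c (t + h) - c t - h%:C * d)); last by ring.
rewrite modulusM (le_trans (ler_wpM2l (modulus_ge0 _) h1)) // !mulrA.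
rewrite ler_wpM2r // ler_pdivrMr // mulrC ler_wpM2l ?(ltW e0) //.
by rewrite lerDr.
Qed.

Lemma rderB c c' t d d' : rder c t d -> rder c' t d' ->
  rder (fun s => c s - c' s) t (d - d').
Proof.
move=> H /(rderZ (-1)) H'; have := rderD H H'; rewrite mulN1r.
by congr rder; apply/funext => s; rewrite mulN1r.
Qed.

Lemma rder_real (v : Cfield R) t : rder (fun s : R => s%:C * v) t v.
Proof.
move=> e e0; exists 1 => // h _.
rewrite (_ : _ - _ - _ = 0) ?modulus0; last by rewrite rmorphD /=; ring.
by rewrite mulr_ge0 // ltW.
Qed.

Lemma is_derive_Re c t d : rder c t d ->
  is_derive t 1 (fun s => complex.Re (c s)) (complex.Re d).
Proof.
move=> H.
have K : h^-1 *: (complex.Re (c (h *: 1 + t)) - complex.Re (c t)) @[h --> 0^'] -->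
    complex.Re d.
  apply/(growth_rate_cvgP (fun s => complex.Re (c s))) => e /H[r r0 Hr].
  exists r => // h /Hr; apply: le_trans; apply: le_trans (Re_le_modulus _).
  case: (c _) => a b; case: (c _) => a' b'; case: d {H Hr} => d d' /=.
  by rewrite mul0r subr0.
by apply: DeriveDef; [apply/cvg_ex; exists (complex.Re d) | exact: cvg_lim].
Qed.

Lemma mean_value_ineq c (d : R -> Cfield R) s t M : (forall u, rder c u (d u)) ->
  (forall u, 0 <= u <= 1 -> modulus (d (s + u * (t - s))) <= M) ->
  modulus (c t - c s) <= M * `|t - s|.
Proof.
move=> Hc HM.
have M0 : 0 <= M.
  by apply: le_trans (HM 0 _); rewrite ?modulus_ge0 ?lexx ?ler01.
wlog st : s t HM / s <= t.
  move=> W; have [st|/ltW ts] := leP s t; first exact: W.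
  rewrite modulusBC distrC; apply: W => // u /andP[u0 u1].
  have := HM (1 - u); rewrite subr_ge0 u1 lerBlDr lerDl u0 => /(_ isT).
  by congr (modulus (d _) <= _); ring.
have [E|N] := eqVneq (c t - c s) 0; first by rewrite E modulus0 mulr_ge0.
have m0 := modulus_gt0 N.
(* Projecting the curve on the direction of its chord reduces to the real
   mean value theorem without losing a constant. *)
pose a := (c t - c s)^*%C / (modulus (c t - c s))%:C : Cfield R.
have a1 : modulus a = 1.
  rewrite /a modulusM -rmorphV ?unitfE ?gt_eqF // modulusC ger0_norm ?invr_ge0 ?ltW //.
  case: (c t - c s) m0 N => x y /=; rewrite /modulus /= sqrrN => m0 _.
  by rewrite divff // gt_eqF.
have Hd (u : R) : is_derive u 1 (fun s => complex.Re (a * c s)) (complex.Re (a * d u)).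
  by apply: is_derive_Re; apply: rderZ.
have [|x xst Hx] := MVT_segment st (fun x _ => Hd x).
  apply: continuous_subspaceT => x; apply: differentiable_continuous.
  by apply/derivable1_diffP; case: (Hd x).
have aE : a * (c t - c s) = (modulus (c t - c s))%:C.
  have mC0 : (modulus (c t - c s))%:C != 0 :> Cfield R by rewrite fmorph_eq0 gt_eqF.
  apply: (mulfI mC0); rewrite /a.
  rewrite mulrC -!mulrA [X in _ * X]mulrCA mulVf // mulr1.
  rewrite -rmorphM -expr2 sqr_modulus.
  by case: (c t - c s) => p q; simpc; congr (_ +i* _); ring.
have ReB (z w : Cfield R) : complex.Re z - complex.Re w = complex.Re (z - w).
  by case: z => ? ?; case: w.
move: Hx; rewrite ReB -mulrBr aE /= => E.
rewrite E (le_trans (ler_norm _)) // normrM ler_wpM2r //.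
rewrite (le_trans (Re_le_modulus _)) // modulusM a1 mul1r.
have ts0 : t - s != 0.
  by apply: contra_neq N => /eqP; rewrite subr_eq0 => /eqP ->; rewrite subrr.
have ts : 0 < t - s by rewrite lt_neqAle eq_sym ts0 subr_ge0.
have := HM ((x - s) / (t - s)).
rewrite divfK // subrKC; apply.
by rewrite divr_ge0 ?subr_ge0 ?(itvP xst) // ler_pdivrMr // mul1r lerD2r (itvP xst).
Qed.

(** The primitives given by the integrals from [- n] differ by constants; normalised
    to vanish at [0], they agree wherever two of them are defined and glue to a primitive
    on the whole line. *)
Lemma continuous_primitive (g : R -> R) : continuous g ->
  exists G : R -> R, forall x : R, is_derive x 1 G (g x).
Proof.
move=> cg.
pose P (n : nat) (x : R) : R := (\int[lebesgue_measure]_(t in `[- n%:R, x]) g t)%R.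
have dP (n : nat) (x : R) : - n%:R < x -> is_derive x 1 (P n) (g x).
  move=> nx; have x1 : x < x + 1 by rewrite ltrDl.
  have ig : lebesgue_measure.-integrable `[- n%:R, x + 1] (EFin \o g).
    apply: continuous_compact_integrable; first exact: segment_compact.
    exact: continuous_subspaceT.
  have [d1 d2] := continuous_FTC1_closed x1 ig nx (cg x).
  by apply: DeriveDef; [exact: d1 | rewrite -derive1E; exact: d2].
have PB (m n : nat) (x : R) : - m%:R < x -> - n%:R < x -> (0 < m)%N -> (0 < n)%N ->
    P m x - P m 0 = P n x - P n 0.
  move=> mx nx m0 n0.
  have dD (y : R) : - m%:R < y -> - n%:R < y -> is_derive y 1 (P m \- P n) 0.
    move=> my ny; rewrite -(subrr (g y)); apply: is_deriveB; exact: dP.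
  have [a b] : - m%:R < (0:R) /\ - n%:R < (0:R) by rewrite !oppr_lt0 !ltr0n.
  have C (u v : R) : - m%:R < u -> - n%:R < u -> u <= v ->
      (P m \- P n) u = (P m \- P n) v.
    move=> mu nu uv.
    have H (y : R) : y \in `[u, v]%R -> is_derive y 1 (P m \- P n) 0.
      by move=> yuv; apply: dD; rewrite (@lt_le_trans _ _ u) // (itvP yuv).
    have Hoo (y : R) : y \in `]u, v[%R -> is_derive y 1 (P m \- P n) 0.
      by move=> yuv; apply: H; rewrite in_itv /= !ltW // (itvP yuv).
    have [|w _] := MVT_segment uv Hoo.
      apply: derivable_within_continuous => y /H; by case.
    by rewrite mul0r => /eqP; rewrite subr_eq0 => /eqP.
  have [x0|/ltW x0] := leP 0 x.
    have /= := C 0 x a b x0; move: (P m x) (P m 0) (P n x) (P n 0) => ????; lra.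
  have /= := C x 0 mx nx x0; move: (P m x) (P m 0) (P n x) (P n 0) => ????; lra.
pose N (x : R) := (Num.truncn `|x|).+1.
have Nx (x : R) : - (N x)%:R < x.
  by rewrite ltrNl (le_lt_trans (ler_norm _)) // normrN truncnS_gt.
exists (fun x => P (N x) x - P (N x) 0) => x.
have : is_derive x 1 (fun y => P (N x) y - P (N x) 0) (g x).
  rewrite -[g x]subr0; apply: is_deriveB; exact: dP.
apply: near_eq_is_derive => //.
near=> y; apply: PB => //; near: y; exact: lt_nbhsr.
Unshelve. all: by end_near. Qed.

Lemma rder_primitive c : (forall t e, 0 < e -> exists2 r, 0 < r &
    forall h, `|h| < r -> modulus (c (t + h) - c t) <= e) ->
  exists C : R -> Cfield R, forall t, rder C t (c t).
Proof.
move=> Hc.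
have cont (p : Cfield R -> R) : (forall z w, p z - p w = p (z - w)) ->
    (forall z, `|p z| <= modulus z) -> continuous (p \o c).
  move=> pB pm t; apply/cvgrPdist_le => e /(Hc t)[r r0 Hr].
  apply/nbhs_ballP; exists r => //= s; rewrite /ball /= => ts.
  rewrite pB (le_trans (pm _)) // modulusBC.
  by have := Hr (s - t); rewrite subrKC; apply; rewrite distrC.
have [|C1 H1] := @continuous_primitive (@complex.Re R \o c).
  by apply: cont => [[? ?] [? ?]|z] //; exact: Re_le_modulus.
have [|C2 H2] := @continuous_primitive (@complex.Im R \o c).
  by apply: cont => [[? ?] [? ?]|z] //; exact: Im_le_modulus.
exists (fun t => of_plane (C1 t, C2 t)) => t e e0.
have e2 : 0 < e / 2 by rewrite divr_gt0.
have D (G : R -> R) (d : R) : is_derive t 1 G d -> exists2 r, 0 < r &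
    forall h, `|h| < r -> `|G (t + h) - G t - h * d| <= e / 2 * `|h|.
  move=> [G1 G2]; move: (e / 2) e2; apply/growth_rate_cvgP.
  by rewrite -G2; exact: G1.
have [r r0 Hr] := D _ _ (H1 t); have [r' r0' Hr'] := D _ _ (H2 t).
exists (Num.min r r'); first by rewrite lt_min r0.
move=> h; rewrite lt_min => /andP[/Hr h1 /Hr' h2].
rewrite (_ : _ - _ - _ = of_plane (C1 (t + h) - C1 t - h * complex.Re (c t),
  C2 (t + h) - C2 t - h * complex.Im (c t))); last first.
  by rewrite /of_plane /=; case: (c t) => p q; simpc.
rewrite (le_trans (modulus_of_plane _ _)) // (le_trans (lerD h1 h2)) //.
by rewrite -mulrDl -splitr.
Qed.

End Curves.

(** * Goursat's theorem and primitives of entire functions *)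

Lemma nested_intervals (R : realType) (a b : nat -> R) :
  (forall n, a n <= a n.+1) -> (forall n, b n.+1 <= b n) -> (forall n, a n <= b n) ->
  exists p, forall n, a n <= p <= b n.
Proof.
move=> ai bd ab.
have am m n : (m <= n)%N -> a m <= a n.
  exact: (@homo_leq _ a (fun x y => x <= y) (fun x => lexx x) (@le_trans _ _)).
have bm m n : (m <= n)%N -> b n <= b m.
  apply: (@homo_leq _ b (fun x y => y <= x) (fun x => lexx x)) => //.
  by move=> y x z xy yz; exact: le_trans xy.
have amb m n : a m <= b n.
  by rewrite (le_trans (am _ _ (leq_maxl m n))) // (le_trans (ab _)) // bm // leq_maxr.
have ub n : ubound (range a) (b n) by move=> _ [m _ <-].
exists (sup (range a)) => n; apply/andP; split.
  by apply: ub_le_sup; [exists (b 0%N); exact: ub | exists n].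
by apply: ge_sup; [exists (a 0%N), 0%N | exact: ub].
Qed.

(** Compactness of squares in a form suited to local-to-global arguments: if [P] failed
    on a square, repeated quartering would give squares on which it fails and which
    shrink to a point, where local validity is contradicted. *)
Lemma square_bisection (R : realType) (P : R -> R -> R -> Prop) :
  (forall x y l, 0 < l -> P x y (l / 2) -> P (x + l / 2) y (l / 2) ->
    P x (y + l / 2) (l / 2) -> P (x + l / 2) (y + l / 2) (l / 2) -> P x y l) ->
  (forall p q, exists2 r : R, 0 < r & forall x y l, 0 < l < r ->
    x <= p <= x + l -> y <= q <= y + l -> P x y l) ->
  forall x y l, 0 < l -> P x y l.
Proof.
move=> quarters locally x0 y0 l0 l00; apply: contrapT => NP.
have /choice[f Hf] : forall s : R * R * R, exists q : R * R,
    0 < s.2 -> ~ P s.1.1 s.1.2 s.2 -> [/\ ~ P q.1 q.2 (s.2 / 2),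
      s.1.1 <= q.1 <= s.1.1 + s.2 / 2 & s.1.2 <= q.2 <= s.1.2 + s.2 / 2].
  move=> [[x y] l] /=; have [l_gt0|l_le0] := ltP 0 l; last by exists (x, y).
  have l2 : 0 < l / 2 by rewrite divr_gt0.
  have e1 (t : R) : t <= t <= t + l / 2 by rewrite lexx lerDl ltW.
  have e2 (t : R) : t <= t + l / 2 <= t + l / 2 by rewrite lexx lerDl ltW.
  have [H1|H1] := pselect (P x y (l / 2)); last by exists (x, y).
  have [H2|H2] := pselect (P (x + l / 2) y (l / 2)); last by exists (x + l / 2, y).
  have [H3|H3] := pselect (P x (y + l / 2) (l / 2)); last by exists (x, y + l / 2).
  exists (x + l / 2, y + l / 2) => _ H; split => //= H4.
  by apply: H; exact: quarters.
pose S n := iter n (fun s : R * R * R => (f s, s.2 / 2)) (x0, y0, l0).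
have lS n : (S n).2 = l0 / 2 ^+ n.
  elim: n => [|n IH]; first by rewrite /S /= expr0 divr1.
  by rewrite /S iterS -/(S n) /= IH exprS invfM mulrCA mulrC mulrA.
have l_gt0 n : 0 < (S n).2 by rewrite lS divr_gt0 // exprn_gt0.
have NS n : ~ P (S n).1.1 (S n).1.2 (S n).2.
  by elim: n => [//|n IH]; have [] := Hf (S n) (l_gt0 n) IH.
have stepS n : (S n).1.1 <= (S n.+1).1.1 <= (S n).1.1 + (S n).2 / 2 /\
    (S n).1.2 <= (S n.+1).1.2 <= (S n).1.2 + (S n).2 / 2.
  by have [] := Hf (S n) (l_gt0 n) (NS n).
have l2S n : (S n.+1).2 = (S n).2 / 2 by [].
have [p Hp] : exists p, forall n, (S n).1.1 <= p <= (S n).1.1 + (S n).2.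
  apply: nested_intervals => n.
  - by have [/andP[]] := stepS n.
  - have [/andP[_ h] _] := stepS n; rewrite l2S.
    by rewrite (le_trans (lerD h (lexx _))) // -addrA -splitr.
  - by rewrite lerDl ltW.
have [q Hq] : exists q, forall n, (S n).1.2 <= q <= (S n).1.2 + (S n).2.
  apply: nested_intervals => n.
  - by have [_ /andP[]] := stepS n.
  - have [_ /andP[_ h]] := stepS n; rewrite l2S.
    by rewrite (le_trans (lerD h (lexx _))) // -addrA -splitr.
  - by rewrite lerDl ltW.
have [r r0 Hr] := locally p q.
pose n := (Num.truncn (l0 / r)).+1.
apply: (NS n); apply: Hr => //; rewrite l_gt0 lS ltr_pdivrMr ?exprn_gt0 //.
rewrite mulrC -ltr_pdivrMr // (lt_trans (truncnS_gt _)) // -/n.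
by rewrite -natrX ltr_nat ltn_expl.
Qed.

Section Goursat.
Context (R : realType) (F F' : Cfield R -> Cfield R) (H V : R -> R -> Cfield R).
Context (HF : forall z, cder F z (F' z)).
Context (HH : forall y x, rder (H y) x (F (of_plane (x, y)))).
Context (HV : forall x y, rder (V x) y (F (of_plane (x, y)))).

(** As [H y] and [V x] are primitives of [F] along horizontal and vertical lines, this
    is the contour integral of [F] along the boundary of a rectangle. *)
Let circ x1 x2 y1 y2 : Cfield R := (H y1 x2 - H y1 x1) - (H y2 x2 - H y2 x1) +
  'i%C * ((V x2 y2 - V x2 y1) - (V x1 y2 - V x1 y1)).

(** The contour integral is additive under subdivision, and on a square of side [l]
    close to a point it is [o(l^2)] by differentiability there; bisection propagates the
    bound [e * l^2] to the whole rectangle, for every [e]. The squares live in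
    the parameter square that [(x1 + a * s, y1 + b * t)] maps onto the rectangle; [a] and
    [b] may have any sign. *)
Lemma goursat x1 x2 y1 y2 : circ x1 x2 y1 y2 = 0.
Proof.
pose a := x2 - x1; pose b := y2 - y1; pose K := `|a| + `|b| + 1.
have K0 : 0 < K by rewrite /K ltr_wpDl ?addr_ge0.
apply: modulus_eq0; apply/eqP; rewrite eq_le modulus_ge0 andbT.
apply/ler_addgt0Pr => e e0; rewrite add0r.
pose P x y l := modulus (circ (x1 + a * x) (x1 + a * (x + l))
  (y1 + b * y) (y1 + b * (y + l))) <= e * l ^+ 2.
suff : P 0 0 1.
  by rewrite /P !mulr0 !addr0 !add0r !mulr1 /a /b !subrKC expr1n mulr1.
apply: (@square_bisection R P) => [x y l l0 h1 h2 h3 h4|p q|//].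
  rewrite /P (_ : circ _ _ _ _ =
    (circ (x1 + a * x) (x1 + a * (x + l / 2)) (y1 + b * y) (y1 + b * (y + l / 2)) +
     circ (x1 + a * (x + l / 2)) (x1 + a * (x + l / 2 + l / 2))
       (y1 + b * y) (y1 + b * (y + l / 2))) +
    (circ (x1 + a * x) (x1 + a * (x + l / 2))
       (y1 + b * (y + l / 2)) (y1 + b * (y + l / 2 + l / 2)) +
     circ (x1 + a * (x + l / 2)) (x1 + a * (x + l / 2 + l / 2))
       (y1 + b * (y + l / 2)) (y1 + b * (y + l / 2 + l / 2)))); last first.
    by rewrite -!addrA -splitr !addrA /circ; ring.
  rewrite (_ : e * _ = (e * (l / 2) ^+ 2 + e * (l / 2) ^+ 2) +
    (e * (l / 2) ^+ 2 + e * (l / 2) ^+ 2)); last by field.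
  by do 2![rewrite (le_trans (modulusD _ _)) // lerD //;
     rewrite (le_trans (modulusD _ _)) // lerD //].
pose w0 : Cfield R := of_plane (x1 + a * p, y1 + b * q).
pose e' := e / (2 * K ^+ 2).
have e'0 : 0 < e' by rewrite divr_gt0 // mulr_gt0 // exprn_gt0.
have [r r0 Hr] := HF w0 e'0.
exists (r / K); first by rewrite divr_gt0.
move=> x y l /andP[l0]; rewrite ltr_pdivlMr // => lr xp yq.
(* The affine part of [F] at [w0] has the primitive [T], hence contributes nothing. *)
pose T (w : Cfield R) := F w0 * w + F' w0 / 2 * ((w - w0) * (w - w0)).
have dT w : cder T w (F w0 + F' w0 * (w - w0)).
  have h1 := cderB (cder_id w) (cder_cst w0 w).
  have h2 := cderD (cderZ (F w0) (cder_id w)) (cderZ (F' w0 / 2) (cderM h1 h1)).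
  suff -> : F w0 + F' w0 * (w - w0) = F w0 * 1 +
    F' w0 / 2 * ((1 - 0) * (w - w0) + (w - w0) * (1 - 0)) by exact: h2.
  by field.
have dTh y' x' : rder (fun s : R => T (of_plane (s, y'))) x'
    (F w0 + F' w0 * (of_plane (x', y') - w0)).
  have E (s : R) : of_plane (s, y') = 'i%C * y'%:C + s%:C * 1.
    by rewrite of_planeE addrC mulr1.
  rewrite [of_plane (x', y')]E -[X in rder _ _ X]mulr1.
  rewrite (_ : (fun s => _) = (fun s : R => T ('i%C * y'%:C + s%:C * 1))).
    by apply: (@rder_line _ T); exact: dT.
  by apply/funext => s; rewrite E.
have dTv x' y' : rder (fun s : R => - 'i%C * T (of_plane (x', s))) y'
    (F w0 + F' w0 * (of_plane (x', y') - w0)).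
  have E (s : R) : of_plane (x', s) = x'%:C + s%:C * 'i%C.
    by rewrite of_planeE mulrC.
  rewrite [of_plane (x', y')]E -[X in rder _ _ X]mul1r.
  have -> : 1 = - 'i%C * 'i%C :> Cfield R by rewrite mulNr -expr2 sqr_i opprK.
  rewrite (_ : (fun s => _) = (fun s : R => - 'i%C * T (x'%:C + s%:C * 'i%C))).
    rewrite -mulrA ['i%C * (_ + _)]mulrC; apply: rderZ.
    by apply: (@rder_line _ T); exact: dT.
  by apply/funext => s; rewrite E.
have inside x' y' : `|x' - (x1 + a * p)| <= `|a| * l ->
    `|y' - (y1 + b * q)| <= `|b| * l ->
    modulus (F (of_plane (x', y')) - (F w0 + F' w0 * (of_plane (x', y') - w0))) <=
    e' * (K * l).
  move=> hx hy; have hw : modulus (of_plane (x', y') - w0) <= (`|a| + `|b|) * l.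
    rewrite (_ : _ - w0 = of_plane (x' - (x1 + a * p), y' - (y1 + b * q))) //.
    by rewrite (le_trans (modulus_of_plane _ _)) // [leRHS]mulrDl lerD.
  have hw' : modulus (of_plane (x', y') - w0) <= K * l.
    by rewrite (le_trans hw) // ler_wpM2r ?(ltW l0) // lerDl.
  have := Hr (of_plane (x', y') - w0).
  rewrite subrKC => /(_ _)/le_trans Hw.
  rewrite opprD addrA [F' w0 * _]mulrC; apply: Hw; last by rewrite ler_wpM2l // ltW.
  by rewrite (le_lt_trans hw') // mulrC.
have coord X A s p' x' : x' <= s <= x' + l -> x' <= p' <= x' + l ->
    `|X + A * s - (X + A * p')| <= `|A| * l.
  move=> /andP[s1 s2] /andP[p1 p2].
  rewrite opprD addrACA subrr add0r -mulrBr normrM ler_wpM2l //.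
  by rewrite ler_distl; apply/andP; split; lra.
have corner (t : R) : t <= t <= t + l /\ t <= t + l <= t + l.
  by rewrite !lexx lerDl ltW.
have along (t u : R) : 0 <= u <= 1 -> t <= t + u * l <= t + l.
  move=> /andP[u0 u1]; rewrite lerDl mulr_ge0 ?(ltW l0) // lerD2l.
  by rewrite ler_piMl // ltW.
have sideH s Y : y <= s <= y + l -> Y = y1 + b * s ->
    modulus ((H Y (x1 + a * (x + l)) - T (of_plane (x1 + a * (x + l), Y))) -
      (H Y (x1 + a * x) - T (of_plane (x1 + a * x, Y)))) <= e' * (K * l) * (`|a| * l).
  move=> ys YE; have D t := rderB (HH Y t) (dTh Y t).
  have -> : `|a| * l = `|x1 + a * (x + l) - (x1 + a * x)|.
    by rewrite -[l in LHS]ger0_norm ?(ltW l0) // -normrM; congr `|_|; ring.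
  apply: (mean_value_ineq D) => u u01; apply: inside; last by rewrite YE; exact: coord yq.
  rewrite (_ : _ + u * _ = x1 + a * (x + u * l)); last by ring.
  by apply: coord xp; exact: along.
have sideV s X : x <= s <= x + l -> X = x1 + a * s ->
    modulus ((V X (y1 + b * (y + l)) - - 'i%C * T (of_plane (X, y1 + b * (y + l)))) -
      (V X (y1 + b * y) - - 'i%C * T (of_plane (X, y1 + b * y)))) <=
    e' * (K * l) * (`|b| * l).
  move=> xs XE; have D t := rderB (HV X t) (dTv X t).
  have -> : `|b| * l = `|y1 + b * (y + l) - (y1 + b * y)|.
    by rewrite -[l in LHS]ger0_norm ?(ltW l0) // -normrM; congr `|_|; ring.
  apply: (mean_value_ineq D) => u u01; apply: inside.
    by rewrite XE; exact: coord xp.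
  rewrite (_ : _ + u * _ = y1 + b * (y + u * l)); last by ring.
  by apply: coord yq; exact: along.
have iE (v t : Cfield R) : 'i%C * (v - - 'i%C * t) = 'i%C * v - t.
  by rewrite mulrBr mulrA mulrN -expr2 sqr_i opprK mul1r.
have [yl yr] := corner y; have [xl xr] := corner x.
have S1 := sideH _ _ yl erefl; have S2 := sideH _ _ yr erefl.
have S3 := sideV _ _ xl erefl; have S4 := sideV _ _ xr erefl.
rewrite /P; set S := (X in _ <= X).
have -> : S = (e' * (K * l) * (`|a| * l) + e' * (K * l) * (`|a| * l)) +
    (e' * (K * l) * (`|b| * l) + e' * (K * l) * (`|b| * l)) +
    2 * e' * (K * l) * l.
  rewrite /S (_ : e * l ^+ 2 = 2 * K ^+ 2 * e' * l ^+ 2); last first.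
    by rewrite /e'; field; rewrite gt_eqF.
  by rewrite /K; ring.
apply: (@le_trans _ _ ((e' * (K * l) * (`|a| * l) + e' * (K * l) * (`|a| * l)) +
    (e' * (K * l) * (`|b| * l) + e' * (K * l) * (`|b| * l)))); last first.
  rewrite lerDl; apply: mulr_ge0 (ltW l0); apply: mulr_ge0 (mulr_ge0 (ltW K0) (ltW l0)).
  exact: mulr_ge0 (ler0n _ 2) (ltW e'0).
apply: le_trans (lerD (le_trans (modulusB _ _) (lerD S1 S2))
  (le_trans (modulusB _ _) (lerD S4 S3))).
rewrite -[X in _ <= _ + X]mul1r -[X in _ <= _ + X * _](modulusi R) -modulusM.
rewrite mulrBr [X in _ <= _ + modulus (X - _)]mulrBr.
rewrite [X in _ <= _ + modulus (_ - X)]mulrBr !iE.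
apply: le_trans (modulusD _ _); rewrite le_eqVlt; apply/orP; left; apply/eqP.
by congr modulus; rewrite /circ; ring.
Qed.

(** Going along the horizontal then the vertical defines a primitive of [F]:
    by [goursat] its increments are also integrals over short paths. *)
Lemma primitive_from_lines : exists G, forall z, cder G z (F z).
Proof.
pose G (z : Cfield R) := (H 0 (complex.Re z) - H 0 0) +
  'i%C * (V (complex.Re z) (complex.Im z) - V (complex.Re z) 0).
exists G => z e e0; case: z => x y.
have e2 : 0 < e / 2 by rewrite divr_gt0.
have [r r0 Hr] := cder_continuous (HF (x +i* y)) e2.
exists (r / 2); first by rewrite divr_gt0.
move=> [k l] hr.
have kr := le_lt_trans (Re_le_modulus _) hr; rewrite /= in kr.
have lr := le_lt_trans (Im_le_modulus _) hr; rewrite /= in lr.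
pose w : Cfield R := x +i* y.
have small (k' l' : R) : `|k'| <= `|k| -> `|l'| <= `|l| ->
    modulus (F (of_plane (x + k', y + l')) - F w) <= e / 2.
  move=> hk hl; have := Hr (of_plane (k', l')).
  rewrite /w /of_plane /=; simpc; apply.
  by rewrite (le_lt_trans (modulus_of_plane _ _)) //; lra.
have um (u m : R) : 0 <= u <= 1 -> `|u * m| <= `|m|.
  by move=> /andP[u0 u1]; rewrite normrM ger0_norm // ler_piMl.
have S1 : modulus ((H y (x + k) - (x + k)%:C * F w) - (H y x - x%:C * F w)) <=
    e / 2 * `|x + k - x|.
  apply: (mean_value_ineq (fun t => rderB (HH y t) (rder_real (F w) t))) => u /um hu.
  rewrite [x + k]addrC addrK -[y in (_, y)]addr0; apply: small => //.
  by rewrite normr0.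
have S2 : modulus ((V (x + k) (y + l) - (y + l)%:C * F w) - (V (x + k) y - y%:C * F w)) <=
    e / 2 * `|y + l - y|.
  have D t := rderB (HV (x + k) t) (rder_real (F w) t).
  apply: (mean_value_ineq D) => u /um hu.
  by rewrite [y + l]addrC addrK; apply: small.
have -> : G (x +i* y + k +i* l) - G (x +i* y) - k +i* l * F (x +i* y) =
    ((H y (x + k) - (x + k)%:C * F w) - (H y x - x%:C * F w)) +
    'i%C * ((V (x + k) (y + l) - (y + l)%:C * F w) - (V (x + k) y - y%:C * F w)).
  have := goursat x (x + k) 0 y; rewrite /circ /G /= => E.
  rewrite -[LHS]subr0 -[X in _ - X = _]E [k +i* l]complexE /= -/w !rmorphD /=.
  ring.
rewrite (le_trans (modulusD _ _)) // modulusM modulusi mul1r.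
rewrite (le_trans (lerD S1 S2)) // [x + k]addrC [y + l]addrC !addrK -mulrDr.
rewrite -mulrA ler_wpM2l ?(ltW e0) // ler_pdivrMl //.
have := Re_le_modulus (k +i* l : Cfield R); have := Im_le_modulus (k +i* l : Cfield R).
by move=> /=; lra.
Qed.

End Goursat.

Lemma primitive_exists (R : realType) (F F' : Cfield R -> Cfield R) :
  (forall z, cder F z (F' z)) -> exists G, forall z, cder G z (F z).
Proof.
move=> HF.
have /choice[H HH] : forall y : R, exists C, forall x, rder C x (F (of_plane (x, y))).
  move=> y; apply: rder_primitive => t e.
  move=> /(cder_continuous (HF (of_plane (t, y))))[r r0 Hr].
  exists r => // h hr.
  rewrite (_ : of_plane (t + h, y) = of_plane (t, y) + h%:C) ?Hr ?modulusC //.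
  by rewrite /of_plane /=; simpc.
have /choice[V HV] : forall x : R, exists C, forall y, rder C y (F (of_plane (x, y))).
  move=> x; apply: rder_primitive => t e.
  move=> /(cder_continuous (HF (of_plane (x, t))))[r r0 Hr].
  exists r => // h hr.
  rewrite (_ : of_plane (x, t + h) = of_plane (x, t) + 'i%C * h%:C).
    by rewrite Hr // modulusM modulusi mul1r modulusC.
  by rewrite /of_plane /=; simpc.
exact: primitive_from_lines HF HH HV.
Qed.

(** * The exponential function *)

Section Exponential.
Context (R : realType).
Implicit Types (z w : Cfield R) (x y : R).

Definition cexp z : Cfield R :=
  (expR (complex.Re z))%:C * of_plane (cos (complex.Im z), sin (complex.Im z)).

Lemma cexp0 : cexp 0 = 1.
Proof. by rewrite /cexp /= expR0 cos0 sin0 mul1r. Qed.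

Lemma cexpD z w : cexp (z + w) = cexp z * cexp w.
Proof.
rewrite /cexp; case: z => a b; case: w => c d /=.
rewrite expRD cosD sinD /of_plane /=; simpc; congr (_ +i* _); ring.
Qed.

Lemma cexpNK z : cexp (- z) * cexp z = 1.
Proof. by rewrite -cexpD addNr cexp0. Qed.

Lemma modulus_cexp z : modulus (cexp z) = expR (complex.Re z).
Proof.
rewrite /cexp modulusM modulusC ger0_norm ?expR_ge0 //.
by rewrite /modulus /of_plane /= cos2Dsin2 sqrtr1 mulr1.
Qed.

Definition period : Cfield R := 'i%C * (2 * pi)%:C.

Lemma cexp_periodic z : cexp (z + period) = cexp z.
Proof.
rewrite cexpD (_ : cexp period = 1) ?mulr1 //.
rewrite /cexp /period; simpc => /=.
by rewrite expR0 !mul1r mulr_natl cos2pi sin2pi.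
Qed.

Lemma periodic_cexpN z : cexp (- (z + period)) = cexp (- z).
Proof. by rewrite -[LHS]cexp_periodic opprD subrK. Qed.

Lemma derive_expansion (f : R -> R) x d : is_derive x 1 f d ->
  forall e, 0 < e -> exists2 r, 0 < r & forall h, `|h| < r ->
  `|f (x + h) - f x - h * d| <= e * `|h|.
Proof. by case=> f1 f2; apply/growth_rate_cvgP; rewrite -f2; exact: f1. Qed.

(** The three-term splitting isolates the errors of the first-order expansions of
    [expR], [cos] and [sin] at [0] and the quadratic term [x * y]. *)
Lemma cder_cexp0 : cder cexp 0 1.
Proof.
move=> e e0; have e8 : 0 < e / 8 by rewrite divr_gt0.
have [r1 r10 H1] := derive_expansion (is_derive_expR (0 : R)) e8.
have [r2 r20 H2] := derive_expansion (is_derive_cos (0 : R)) e8.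
have [r3 r30 H3] := derive_expansion (is_derive_sin (0 : R)) e8.
exists (Num.min (Num.min r1 1) (Num.min (Num.min r2 r3) (e / 8))).
  by rewrite !lt_min r10 ltr01 r20 r30 e8.
move=> [x y]; rewrite !lt_min => /andP[/andP[h1 h1'] /andP[/andP[h2 h3] h4]].
have xm := Re_le_modulus (x +i* y : Cfield R).
have ym := Im_le_modulus (x +i* y : Cfield R).
move: (modulus _) xm ym h1 h1' h2 h3 h4 => m xm ym h1 h1' h2 h3 h4.
rewrite /= in xm ym.
have {}H1 := H1 _ (le_lt_trans xm h1); have {}H2 := H2 _ (le_lt_trans ym h2).
have {}H3 := H3 _ (le_lt_trans ym h3).
rewrite expR0 cos0 sin0 oppr0 !add0r mulr0 !subr0 !mulr1 ?addr0 in H1 H2 H3.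
rewrite add0r cexp0 mulr1.
have -> : cexp (x +i* y) - 1 - x +i* y =
  (expR x - 1 - x)%:C * of_plane (cos y, sin y) +
  (1 + x)%:C * of_plane (cos y - 1, sin y - y) + of_plane (0, x * y).
  by rewrite /cexp /of_plane /=; simpc; congr (_ +i* _); ring.
have t1 : modulus (of_plane (cos y, sin y)) = 1.
  by rewrite /modulus /of_plane /= cos2Dsin2 sqrtr1.
have m0 : 0 <= m by exact: le_trans xm.
apply: le_trans (modulusD _ _) _; apply: le_trans (lerD (modulusD _ _) (lexx _)) _.
rewrite !modulusM !modulusC t1 mulr1.
have b2 := modulus_of_plane (cos y - 1) (sin y - y).
have b3 := modulus_of_plane 0 (x * y).
have b1x : `|1 + x| <= 2.
  by rewrite (le_trans (ler_normD _ _)) // normr1; lra.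
have b4 : modulus (of_plane (cos y - 1, sin y - y)) <= e / 4 * m.
  rewrite (le_trans b2) //.
  have := ler_wpM2l (ltW e8) ym; lra.
have b5 : `|x * y| <= e / 8 * m.
  by rewrite normrM ler_pM // (le_trans xm) // ltW.
have b6 : `|1 + x| * modulus (of_plane (cos y - 1, sin y - y)) <= 2 * (e / 4 * m).
  by rewrite ler_pM ?modulus_ge0.
rewrite normr0 add0r in b3.
have := ler_wpM2l (ltW e8) xm.
have : 0 <= e * m by rewrite mulr_ge0 // ltW.
lra.
Qed.

Lemma cder_cexp z : cder cexp z (cexp z).
Proof.
move=> e e0; have m0 : 0 < modulus (cexp z) by rewrite modulus_cexp expR_gt0.
have [r r0 Hr] := cder_cexp0 (divr_gt0 e0 m0); exists r => // h /Hr.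
rewrite add0r cexp0 mulr1 mulrAC ler_pdivlMr // mulrC -modulusM.
by congr (modulus _ <= _); rewrite cexpD; ring.
Qed.

Lemma cder_cexpN z : cder (fun w => cexp (- w)) z (- cexp (- z)).
Proof.
have h : cder (fun w => - w) z (-1).
  have := cderB (cder_cst 0 z) (cder_id z); rewrite add0r.
  by apply: cder_ext => w; rewrite add0r.
by have := cder_comp h (cder_cexp (- z)); rewrite mulrN1.
Qed.

Lemma cder_cexpNX n z :
  cder (fun w => cexp (- w) ^+ n) z (- (n%:R * cexp (- z) ^+ n)).
Proof.
elim: n => [|n IH].
  rewrite mul0r oppr0; apply: cder_ext (cder_cst 1 z) => w; by rewrite expr0.
have := cderM (cder_cexpN z) IH.
rewrite (_ : _ + _ = - (n.+1%:R * cexp (- z) ^+ n.+1)); last first.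
  by rewrite exprS -natr1; ring.
by apply: cder_ext => w; rewrite exprS.
Qed.

End Exponential.

(** * Means over circles *)

Section Mean.
Context (R : realType).
Implicit Types (F G : Cfield R -> Cfield R) (z w m : Cfield R).

(** The mean of a periodic function over a vertical segment of length [2 pi], encoded by
    a primitive instead of an integral. For [F w := f (z + cexp w)] it is the mean of [f]
    over a circle around [z], of radius [expR (Re w)]. *)
Definition mean F m := exists G, (forall w, cder G w (F w)) /\
  forall w, G (w + period R) - G w = period R * m.

Lemma period_neq0 : period R != 0.
Proof.
rewrite /period mulf_neq0 //; first by rewrite eq_complex /= oner_eq0 andbF.
by rewrite fmorph_eq0 mulf_neq0 // gt_eqF // pi_gt0.
Qed.

Lemma meanD F F' m m' : mean F m -> mean F' m' -> mean (fun w => F w + F' w) (m + m').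
Proof.
move=> [G [dG pG]] [G' [dG' pG']]; exists (fun w => G w + G' w); split=> w.
  exact: cderD.
by rewrite opprD addrACA pG pG' mulrDr.
Qed.

Lemma meanZ a F m : mean F m -> mean (fun w => a * F w) (a * m).
Proof.
move=> [G [dG pG]]; exists (fun w => a * G w); split=> w; first exact: cderZ.
by rewrite -mulrBr pG mulrCA.
Qed.

Lemma mean_ext F F' m : F =1 F' -> mean F m -> mean F' m.
Proof. by move=> /funext ->. Qed.

Lemma meanB F F' m m' : mean F m -> mean F' m' -> mean (fun w => F w - F' w) (m - m').
Proof.
move=> H /(meanZ (-1)) H'; have := meanD H H'; rewrite mulN1r.
by apply: mean_ext => w; rewrite mulN1r.
Qed.

Lemma mean_cst a : mean (fun=> a) a.
Proof.
exists (fun w => a * w); split=> w.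
  by rewrite -[X in cder _ _ X]mulr1; exact: cderZ (cder_id w).
by rewrite -mulrBr addrAC subrr add0r mulrC.
Qed.

Lemma mean_derivative F G : (forall w, cder G w (F w)) ->
  (forall w, G (w + period R) = G w) -> mean F 0.
Proof. by move=> dG pG; exists G; split=> // w; rewrite pG subrr mulr0. Qed.

Lemma mean_value_segment F G z w M : (forall u, cder G u (F u)) ->
  (forall t : R, 0 <= t <= 1 -> modulus (F (z + t%:C * (w - z))) <= M) ->
  modulus (G w - G z) <= M * modulus (w - z).
Proof.
move=> dG HM; have c t := rder_line (dG (z + t%:C * (w - z))).
have := mean_value_ineq c (s := 0) (t := 1) (M := M * modulus (w - z)).
rewrite subr0 normr1 mulr1 mul0r addr0 mul1r subrKC; apply => u u01.
by rewrite mulr1 add0r modulusM ler_wpM2r ?modulus_ge0 // HM.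
Qed.

Lemma cder0_cst G z w : (forall u, cder G u 0) -> G z = G w.
Proof.
move=> dG; apply/eqP; rewrite -subr_eq0; apply/eqP/modulus_eq0/le_anti.
rewrite modulus_ge0 andbT -(mul0r (modulus (z - w))).
by apply: (mean_value_segment dG) => t _; rewrite modulus0.
Qed.

(** The increment of a primitive over one period has derivative [0], hence it is the same
    at all points: this is how means become independent of the radius. *)
Lemma mean_exists F F' : (forall w, cder F w (F' w)) ->
  (forall w, F (w + period R) = F w) -> exists m, mean F m.
Proof.
move=> /primitive_exists[G dG] pF.
exists ((G (period R) - G 0) / period R), G; split=> // w.
rewrite [RHS]mulrC divfK ?period_neq0 //.
have D u : cder (fun v => G (v + period R) - G v) u 0.
  rewrite -(subrr (F u)); apply: cderB => //.
  rewrite -[X in cder _ _ X]mulr1; apply: (@cder_comp _ G (fun v => v + period R)).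
    by rewrite -[1]addr0; apply: cderD; [exact: cder_id | exact: cder_cst].
  by rewrite -(pF u); exact: dG.
by rewrite (cder0_cst w 0 D) add0r.
Qed.

(** A single vertical line, that is a single circle, is enough to bound a mean. *)
Lemma mean_le F m (u M : R) : mean F m ->
  (forall w, complex.Re w = u -> modulus (F w) <= M) -> modulus m <= M.
Proof.
move=> [G [dG pG]] HM; have p0 := modulus_gt0 period_neq0.
rewrite -(ler_pM2l p0) -modulusM -(pG u%:C) mulrC.
have E : u%:C + period R - u%:C = period R by rewrite addrC addKr.
have := mean_value_segment (z := u%:C) (w := u%:C + period R) (M := M) dG.
rewrite E; apply => t _; apply: HM.
by rewrite /period; simpc.
Qed.

End Mean.

(** * Cauchy's formulas *)

Section CauchyFormulas.
Context (R : realType).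
Implicit Types (f : Cfield R -> Cfield R) (z w m : Cfield R).

Lemma cder_circle f z w d : cder f (z + cexp w) d ->
  cder (fun v => f (z + cexp v)) w (d * cexp w).
Proof.
apply: (@cder_comp _ f (fun v => z + cexp v)).
by rewrite -[cexp w]add0r; apply: cderD; [exact: cder_cst | exact: cder_cexp].
Qed.

Lemma cder_circleX f z w d n : cder f (z + cexp w) d ->
  cder (fun v => f (z + cexp v) * cexp (- v) ^+ n.+1) w
    (d * cexp (- w) ^+ n - n.+1%:R * (f (z + cexp w) * cexp (- w) ^+ n.+1)).
Proof.
move=> /cder_circle h; have := cderM h (cder_cexpNX n.+1 w).
congr cder; rewrite exprS -mulrA [cexp w * _]mulrA [cexp w * _]mulrC cexpNK mul1r.
by ring.
Qed.

(** Integration by parts: [f (z + cexp w) * cexp (- w) ^+ n.+1] is periodic, so its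
    derivative has mean zero. Read from right to left, it produces means of [f'] before
    [f'] is known to be differentiable. *)
Lemma mean_by_parts f f' z n m : (forall w, cder f w (f' w)) ->
  mean (fun w => f' (z + cexp w) * cexp (- w) ^+ n) m <->
  mean (fun w => f (z + cexp w) * cexp (- w) ^+ n.+1) (m / n.+1%:R).
Proof.
move=> df; have n0 : n.+1%:R != 0 :> Cfield R by rewrite pnatr_eq0.
pose F w := f' (z + cexp w) * cexp (- w) ^+ n.
pose G w := f (z + cexp w) * cexp (- w) ^+ n.+1.
have P : mean (fun w => F w - n.+1%:R * G w) 0.
  apply: (mean_derivative (G := G)) => w; first exact: cder_circleX.
  by rewrite /G cexp_periodic periodic_cexpN.
split=> H.
  have := meanZ (n.+1%:R)^-1 (meanB H P); rewrite subr0 mulrC.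
  by apply: mean_ext => w; rewrite subKr mulKf.
have := meanD P (meanZ n.+1%:R H); rewrite add0r mulrC divfK //.
by apply: mean_ext => w; rewrite /F subrK.
Qed.

Lemma modulus_cexpNX w n : modulus (cexp (- w) ^+ n) = expR (complex.Re w) ^- n.
Proof. by rewrite modulusX modulus_cexp; case: w => a b /=; rewrite expRN exprVn. Qed.

(** The mean exists by periodicity and does not depend on the radius of the circle;
    its value is read off on circles shrinking to [z]. *)
Lemma mean_first_derivative f f' z : (forall w, cder f w (f' w)) ->
  mean (fun w => f (z + cexp w) * cexp (- w) ^+ 1) (f' z).
Proof.
move=> df; pose G w := f (z + cexp w) * cexp (- w) ^+ 1.
have [|m Hm] := @mean_exists _ G _ (fun w => cder_circleX 0 (df (z + cexp w))).
  by move=> w; rewrite /G cexp_periodic periodic_cexpN.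
suff <- : m = f' z by exact: Hm.
have E0 : mean (fun w : Cfield R => cexp (- w) ^+ 1) 0.
  apply: (mean_derivative (G := fun w => -1 * cexp (- w))) => w; last first.
    by rewrite periodic_cexpN.
  by have := cderZ (-1) (cder_cexpN w); rewrite mulrNN mul1r.
have := meanB (meanB Hm (meanZ (f z) E0)) (mean_cst (f' z)).
rewrite mulr0 subr0 => HD.
apply/eqP; rewrite -subr_eq0; apply/eqP/modulus_eq0/le_anti; rewrite modulus_ge0 andbT.
apply/ler_addgt0Pr => e e0; rewrite add0r; have [r r0 Hr] := df z e e0.
have r2 : 0 < r / 2 by rewrite divr_gt0.
apply: (mean_le (u := ln (r / 2)) HD) => w wu.
have hw : modulus (cexp w) = r / 2 by rewrite modulus_cexp wu lnK.
have /Hr H : modulus (cexp w) < r by rewrite hw; lra.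
rewrite (_ : _ - _ - _ = (f (z + cexp w) - f z - cexp w * f' z) * cexp (- w) ^+ 1).
  rewrite modulusM modulus_cexpNX wu lnK // expr1 ler_pdivrMr // -hw; exact: H.
rewrite expr1 /G expr1 -[f' z in LHS]mul1r -(cexpNK w); ring.
Qed.

(** The value of a function is the first derivative of a primitive, which starts the
    induction; each integration by parts then lowers the order by one. *)
Lemma mean_derivatives (fs : nat -> Cfield R -> Cfield R) z n :
  (forall n w, cder (fs n) w (fs n.+1 w)) ->
  mean (fun w => fs 0 (z + cexp w) * cexp (- w) ^+ n) (fs n z / n`!%:R).
Proof.
elim: n fs => [|n IH] fs dfs.
  have [G dG] := primitive_exists (dfs 0%N).
  apply/(mean_by_parts z 0 _ dG); rewrite divr1 divr1; exact: mean_first_derivative.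
have := IH (fun n => fs n.+1) (fun n => dfs n.+1).
move=> /(mean_by_parts z n _ (dfs 0%N)).
by rewrite factS natrM invfM mulrA mulrAC.
Qed.

Lemma cauchy_estimate (fs : nat -> Cfield R -> Cfield R) z n (s M : R) :
  (forall n w, cder (fs n) w (fs n.+1 w)) -> 0 < s ->
  (forall w, modulus (w - z) = s -> modulus (fs 0%N w) <= M) ->
  modulus (fs n z) <= n`!%:R * M / s ^+ n.
Proof.
move=> dfs s0 HM.
have n0 : 0 < n`!%:R :> R by rewrite ltr0n fact_gt0.
have := mean_le (u := ln s) (M := M / s ^+ n) (mean_derivatives z n dfs).
have -> : (n`!%:R)^-1 = ((n`!%:R)^-1)%:C :> Cfield R by rewrite fmorphV rmorph_nat.
rewrite modulusM modulusC ger0_norm ?invr_ge0 ?(ltW n0) // ler_pdivrMr //.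
rewrite [_ * n`!%:R]mulrC [leRHS]mulrA; apply.
move=> w wu; rewrite modulusM modulus_cexpNX wu lnK //.
rewrite ler_wpM2r ?invr_ge0 ?exprn_ge0 ?(ltW s0) //.
by apply: HM; rewrite addrAC subrr add0r modulus_cexp wu lnK.
Qed.

Lemma cauchy_estimate1 f f' z (s M : R) : (forall w, cder f w (f' w)) -> 0 < s ->
  (forall w, modulus (w - z) = s -> modulus (f w) <= M) -> modulus (f' z) <= M / s.
Proof.
move=> df s0 HM; apply: (mean_le (u := ln s) (mean_first_derivative z df)) => w wu.
rewrite modulusM modulus_cexpNX wu lnK // expr1 ler_wpM2r ?invr_ge0 ?(ltW s0) //.
by apply: HM; rewrite addrAC subrr add0r modulus_cexp wu lnK.
Qed.

(** Local boundedness of a continuous function propagates by bisection. *)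
Lemma bounded_on_disks f f' z (r : R) : (forall w, cder f w (f' w)) ->
  exists B, forall w, modulus (w - z) <= r -> modulus (f w) <= B.
Proof.
move=> df.
pose P x y l := exists B, forall p q : R, x <= p <= x + l -> y <= q <= y + l ->
  modulus (f (of_plane (p, q))) <= B.
have [B HB] : P (complex.Re z - `|r|) (complex.Im z - `|r|) (2 * `|r| + 1).
  apply: (@square_bisection R P); last by rewrite ltr_wpDl // mulr_ge0.
    move=> x y l l0 [B1 H1] [B2 H2] [B3 H3] [B4 H4].
    exists (Num.max (Num.max B1 B2) (Num.max B3 B4)) => p q /andP[p1 p2] /andP[q1 q2].
    rewrite !le_max; have [px|/ltW px] := leP p (x + l / 2);
      have [qy|/ltW qy] := leP q (y + l / 2).
    - by rewrite H1 ?p1 ?q1.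
    - by rewrite H3 ?p1 ?px ?qy ?orbT //; lra.
    - by rewrite H2 ?q1 ?px ?qy ?orbT //; lra.
    - by rewrite H4 ?px ?qy ?orbT //; lra.
  move=> p q; have [d d0 Hd] := cder_continuous (df (of_plane (p, q))) ltr01.
  exists (d / 2); first by rewrite divr_gt0.
  move=> x y l /andP[l0 ld] /andP[p1 p2] /andP[q1 q2].
  exists (1 + modulus (f (of_plane (p, q)))) => p' q' /andP[p1' p2'] /andP[q1' q2'].
  pose h : Cfield R := of_plane (p' - p, q' - q).
  have -> : f (of_plane (p', q')) = (f (of_plane (p, q) + h) - f (of_plane (p, q))) +
      f (of_plane (p, q)).
    by rewrite subrK /h; congr f; rewrite /of_plane /=; simpc; rewrite !subrKC.
  rewrite (le_trans (modulusD _ _)) // lerD2r Hd //.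
  rewrite (le_lt_trans (modulus_of_plane _ _)) //.
  have : `|p' - p| <= l by rewrite ler_distl; apply/andP; split; lra.
  have : `|q' - q| <= l by rewrite ler_distl; apply/andP; split; lra.
  lra.
exists B => w wr.
have := le_trans (Re_le_modulus _) wr; have := le_trans (Im_le_modulus _) wr.
have rr := ler_norm r; have r0 := normr_ge0 r.
rewrite [w]ReIm_of_plane; case: z HB {wr} => zx zy /= HB.
case: w => wx wy /=; rewrite !ler_norml => /andP[a1 a2] /andP[b1 b2].
by apply: HB; apply/andP; split; lra.
Qed.

(** The Cauchy bound applied to [f (v + h) - f v] makes [f'] Lipschitz near [z], so the
    first-order expansion of [f] has an error [B * |h|^2] that is uniform on the unit
    circle around [z]. Taking means against [cexp (- w)] transfers this error bound to
    [f'] at [z]. The derivative is the mean of [f' (z + cexp w) * cexp (- w)], which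
    exists by integration by parts. *)
Lemma derivative_differentiable f f' z : (forall w, cder f w (f' w)) ->
  exists d, cder f' z d.
Proof.
move=> df; have [B HB] := bounded_on_disks z 4 df.
have B0 : 0 <= B by apply: le_trans (HB z _); rewrite ?modulus_ge0 // subrr modulus0.
have tri (a b c : Cfield R) : modulus (b - c) <= modulus (b - a) + modulus (a - c).
  by rewrite -(subrK a b) -addrA [X in modulus (X - a)]subrK modulusD.
have B1 w : modulus (w - z) <= 3 -> modulus (f' w) <= B.
  move=> wz; rewrite -[B]divr1; apply: (cauchy_estimate1 df ltr01) => v vw.
  by apply: HB; have := tri w v z; rewrite vw; lra.
have dshift (h : Cfield R) w : cder (fun v => f (v + h)) w (f' (w + h)).
  rewrite -[X in cder _ _ X]mulr1; apply: (@cder_comp _ f (fun v => v + h)) => //.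
  by rewrite -[1]addr0; apply: cderD; [exact: cder_id | exact: cder_cst].
have scaled (t : R) (h : Cfield R) : 0 <= t <= 1 -> modulus (t%:C * h) <= modulus h.
  move=> /andP[t0 t1]; rewrite modulusM modulusC ger0_norm //.
  by rewrite ler_piMl ?modulus_ge0.
have D1 w (h : Cfield R) : modulus (w - z) <= 1 -> modulus h <= 1 ->
    modulus (f' (w + h) - f' w) <= B * modulus h.
  move=> wz h1; rewrite -[leRHS]divr1.
  apply: (cauchy_estimate1 (fun v => cderB (dshift h v) (df v)) ltr01) => v vw.
  rewrite -[X in B * modulus X](addrK v) [h + v]addrC.
  apply: (mean_value_segment df) => t t01; apply: B1.
  rewrite [v + h]addrC addrK; have := scaled t h t01; have := tri w v z.
  by have := tri v (v + t%:C * h) z; rewrite [v + _ - v]addrC addKr vw; lra.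
have D2 w (h : Cfield R) : modulus (w - z) <= 1 -> modulus h <= 1 ->
    modulus (f (w + h) - f w - h * f' w) <= B * modulus h * modulus h.
  move=> wz h1.
  have -> : f (w + h) - f w - h * f' w =
      (f (w + h) - f' w * (w + h)) - (f w - f' w * w) by ring.
  have dl v : cder (fun v => f v - f' w * v) v (f' v - f' w).
    by apply: cderB => //; rewrite -[X in cder _ _ X]mulr1; apply: cderZ; exact: cder_id.
  rewrite -[X in _ <= _ * modulus X](addrK w) [h + w]addrC.
  apply: (mean_value_segment dl) => t t01.
  rewrite [w + h]addrC addrK.
  have th := scaled t h t01; rewrite (le_trans (D1 _ _ wz (le_trans th h1))) //.
  exact: ler_wpM2l.
have [|m Hm] := @mean_exists _ (fun w => f (z + cexp w) * cexp (- w) ^+ 2) _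
  (fun w => cder_circleX 1 (df (z + cexp w))).
  by move=> w; rewrite cexp_periodic periodic_cexpN.
pose c := m * 2; have Hc : mean (fun w => f' (z + cexp w) * cexp (- w) ^+ 1) c.
  by apply/(mean_by_parts z 1 _ df); rewrite /c mulfK // pnatr_eq0.
exists c => e e0; exists (Num.min 1 (e / (B + 1))).
  by rewrite lt_min ltr01 divr_gt0 // ltr_wpDl.
move=> h; rewrite lt_min => /andP[h1 he].
have Bh : B * modulus h <= e.
  move: he; rewrite ltr_pdivlMr ?ltr_wpDl // => /ltW; apply: le_trans.
  by rewrite mulrDr mulr1 mulrC lerDl modulus_ge0.
apply: le_trans (ler_wpM2r (modulus_ge0 h) Bh).
have := meanB (meanB (mean_first_derivative (z + h) df) (mean_first_derivative z df))
  (meanZ h Hc).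
move/(mean_le (u := 0)); apply => w w0.
rewrite (_ : _ - _ - _ = (f (z + cexp w + h) - f (z + cexp w) - h * f' (z + cexp w)) *
  cexp (- w) ^+ 1); last by rewrite [z + h + _]addrAC; ring.
rewrite modulusM modulus_cexpNX w0 expR0 expr1 invr1 mulr1 D2 ?(ltW h1) //.
by rewrite addrAC subrr add0r modulus_cexp w0 expR0.
Qed.

Lemma entire_derivatives f : entire f -> forall n z,
  cder (f^`(n)%classic) z (f^`(n.+1)%classic z).
Proof.
move=> ef; elim=> [|n IH] z.
  by rewrite derive1n0 derive1n1; apply: derivable_cder; exact: ef.
have [d Hd] := derivative_differentiable z IH.
by rewrite [f^`(n.+2)%classic]derive1nS (cder_derive1 Hd).
Qed.

End CauchyFormulas.

(** * The local square mean bound *)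

(** The integral of a nonnegative function is the supremum of the integrals of the simple
    functions below it, so this comparison holds for arbitrary [f] and [D]. *)
Lemma ge0_integral_ge_rect d (T : measurableType d) (R : realType)
    (mu : {measure set T -> \bar R}) (A D : set T) (f : T -> R) (m : R) :
  measurable A -> A `<=` D -> 0 <= m -> (forall x, D x -> 0 <= f x) ->
  (forall x, A x -> m <= f x) ->
  (m%:E * mu A <= \int[mu]_(x in D) (f x)%:E)%E.
Proof.
move=> mA AD m0 f0 mf; rewrite -integral_cst //.
rewrite !ge0_integralE => [|x Dx|x Ax]; rewrite ?lee_fin ?f0 //.
apply: ereal_sup_le => _ [h /= hA <-]; exists h => //= x.
apply: le_trans (hA x) _; rewrite /patch; case: ifPn => [xA|_].
  have Ax := set_mem xA; rewrite mem_set ?lee_fin ?mf //; exact: AD.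
by case: ifPn => // /set_mem; rewrite lee_fin; exact: f0.
Qed.

Section LocalBound.
Context (R : realType).
Implicit Types (f g : Cfield R -> Cfield R) (z w : Cfield R).

Lemma modulus_triangle z w (v : Cfield R) :
  modulus (w - v) <= modulus (w - z) + modulus (z - v).
Proof. by rewrite -(subrK z w) -addrA [X in modulus (X - z)]subrK modulusD. Qed.

(** The point [z] nearly maximises [|g v| * (D - |v - w|)] over the disk, and [d] is its
    distance to the boundary circle. Near-maximality bounds [|g|] by [4 * |g z|] at
    distance [d / 2], hence the derivative by [16 * |g z| / d] at distance [d / 4]; over a
    distance [d / 32] the function loses at most half of its size. *)
Lemma slow_variation_point g g' w (D : R) : (forall z, cder g z (g' z)) ->
  0 < D -> g w != 0 -> exists z (d : R), [/\ 0 < d, modulus (z - w) + d <= D,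
    D * modulus (g w) <= 2 * d * modulus (g z) &
    forall v, modulus (v - z) <= d / 32 -> modulus (g z) <= 2 * modulus (g v)].
Proof.
move=> dg D0 gw0; have [B HB] := bounded_on_disks w D dg.
pose phi z := modulus (g z) * (D - modulus (z - w)).
pose E := phi @` [set z | modulus (z - w) <= D].
have Ew : E (phi w) by exists w => //=; rewrite subrr modulus0 ltW.
have phiw : phi w = D * modulus (g w).
  by rewrite /phi subrr modulus0 subr0 mulrC.
have hE : has_sup E.
  split; first by exists (phi w).
  exists (B * D) => _ [z /= zD <-]; apply: ler_pM; rewrite ?modulus_ge0 ?subr_ge0 ?HB //.
  by rewrite gerBl modulus_ge0.
have ES z : modulus (z - w) <= D -> phi z <= sup E.
  by move=> zD; apply: ub_le_sup; [case: hE | exists z].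
have S0 : 0 < sup E.
  apply: lt_le_trans (ES w _); last by rewrite subrr modulus0 ltW.
  by rewrite phiw mulr_gt0 // modulus_gt0.
have [_ [z /= zD <-]] := sup_adherent (divr_gt0 S0 (ltr0n _ 2 : 0 < 2)) hE.
rewrite {1}[sup E]splitr addrK => zS.
pose d := D - modulus (z - w).
have d0 : 0 < d.
  rewrite lt_neqAle subr_ge0 zD andbT; apply: contraTneq zS => d0.
  by rewrite /phi -/d -d0 mulr0 -leNgt divr_ge0 // ltW.
have gz0 := modulus_ge0 (g z).
have near v : modulus (v - z) <= d / 2 -> modulus (g v) <= 4 * modulus (g z).
  move=> vz; have vD : modulus (v - w) <= D - d / 2.
    by have := modulus_triangle z v w; rewrite /d in d0 vz *; lra.
  have := ES v; rewrite /phi => /(_ _) H.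
  have {}H : modulus (g v) * (D - modulus (v - w)) <= sup E by apply: H; lra.
  have H2 : modulus (g v) * (d / 2) <= modulus (g v) * (D - modulus (v - w)).
    by rewrite ler_wpM2l ?modulus_ge0 //; lra.
  rewrite -(ler_pM2r d0); move: zS; rewrite /phi -/d; lra.
have slope v : modulus (v - z) <= d / 4 -> modulus (g' v) <= 4 * modulus (g z) / (d / 4).
  move=> vz; apply: (cauchy_estimate1 dg); first by rewrite divr_gt0.
  by move=> u uv; apply: near; have := modulus_triangle v u z; lra.
exists z, d; split=> //.
- by rewrite /d; lra.
- have := ES w; rewrite phiw subrr modulus0 => /(_ (ltW D0)).
  by move: zS; rewrite /phi -/d; lra.
- move=> v vz.
  have : modulus (g v - g z) <= 4 * modulus (g z) / (d / 4) * modulus (v - z).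
    apply: (mean_value_segment dg) => t /andP[t0 t1]; apply: slope.
    rewrite addrAC subrr add0r modulusM modulusC ger0_norm //.
    rewrite (le_trans (ler_piMl (modulus_ge0 _) t1)) //; lra.
  have : 4 * modulus (g z) / (d / 4) * modulus (v - z) <=
      4 * modulus (g z) / (d / 4) * (d / 32).
    by rewrite ler_wpM2l // !mulr_ge0 // invr_ge0 divr_ge0 // ltW.
  have -> : 4 * modulus (g z) / (d / 4) * (d / 32) = modulus (g z) / 2.
    by field; rewrite gt_eqF.
  have := modulusB (g v) (g v - g z); rewrite subKr; lra.
Qed.

Definition gauss_density f z : R :=
  modulus (f z * (expR (- modulus z ^+ 2 / 2))%:C) ^+ 2.

Lemma gauss_densityE f z :
  gauss_density f z = modulus (f z) ^+ 2 * expR (- modulus z ^+ 2).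
Proof.
rewrite /gauss_density modulusM modulusC ger0_norm ?expR_ge0 // exprMn; congr (_ * _).
by rewrite [expR _ ^+ 2]expr2 -expRD -splitr.
Qed.

(** The holomorphic factor that recentres the Gaussian weight at [w]. *)
Definition twist w f z := f z * cexp (- (w^*%C * z)).

Lemma gauss_density_twist w f z :
  gauss_density f z =
  modulus (twist w f z) ^+ 2 * expR (modulus w ^+ 2 - modulus (z - w) ^+ 2).
Proof.
rewrite gauss_densityE /twist modulusM modulus_cexp exprMn -[RHS]mulrA; congr (_ * _).
rewrite [expR _ ^+ 2]expr2 -!expRD !sqr_modulus; congr (expR _).
by case: w => a b; case: z => c e /=; ring.
Qed.

Lemma cder_twist w f z d : cder f z d ->
  exists d', cder (twist w f) z d'.
Proof.
move=> df; have h := cder_comp (cderZ (- w^*%C) (cder_id z)) (cder_cexp _).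
have := cderM df h.
rewrite (_ : (fun v => _) = twist w f); last first.
  by apply/funext => v; rewrite /twist /= mulNr.
by move=> H; eexists; exact: H.
Qed.

(** The lower bound on the integral comes from a square of side [d / 32] centred at a
    point of slow variation of [twist w f]; half its diagonal is within [d / 32]. *)
Lemma gauss_density_le_integral f f' z w (r D : R) : (forall z, cder f z (f' z)) ->
  0 < D -> modulus (w - z) + D <= r ->
  ((gauss_density f w * (D ^+ 2 * expR (- D ^+ 2) / 128 ^+ 2))%:E <=
   disk_integral z r (gauss_density f))%E.
Proof.
move=> df D0 wr; have dens0 v : 0 <= gauss_density f v by exact: sqr_ge0.
have /choice[g' dg] : forall v, exists d, cder (twist w f) v d.
  by move=> v; exact: cder_twist (df v).
have dw : gauss_density f w = modulus (twist w f w) ^+ 2 * expR (modulus w ^+ 2).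
  by rewrite (gauss_density_twist w) subrr modulus0 expr0n subr0.
have [gw0|gw0] := eqVneq (twist w f w) 0.
  rewrite dw gw0 modulus0 expr0n !mul0r; apply: integral_ge0 => p _.
  by rewrite lee_fin dens0.
have [z0 [d [d0 dD Dd slow]]] := slow_variation_point dg D0 gw0.
pose a := d / 64; pose x0 := complex.Re z0; pose y0 := complex.Im z0.
pose A : set (R * R) := `[x0 - a, x0 + a] `*` `[y0 - a, y0 + a].
have Az0 p : A p -> modulus (of_plane p - z0) <= d / 32.
  case: p => p q [] /=; rewrite !in_itv /= => /andP[p1 p2] /andP[q1 q2].
  rewrite [z0]ReIm_of_plane -/x0 -/y0.
  rewrite (_ : _ - _ = of_plane (p - x0, q - y0)) ?(le_trans (modulus_of_plane _ _)) //.
  have : `|p - x0| <= a by rewrite ler_distl p1 p2.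
  have : `|q - y0| <= a by rewrite ler_distl q1 q2.
  by rewrite /a; lra.
pose m := modulus (twist w f z0) ^+ 2 / 4 * expR (modulus w ^+ 2 - D ^+ 2).
have m0 : 0 <= m by rewrite mulr_ge0 ?expR_ge0 // divr_ge0 // sqr_ge0.
have a0 : 0 < a by rewrite divr_gt0.
have mA : measurable A by apply: measurableX; exact: measurable_itv.
have Am p : A p -> m <= gauss_density f (of_plane p).
  move=> Ap; rewrite (gauss_density_twist w); apply: ler_pM.
  all: rewrite ?expR_ge0 ?divr_ge0 ?sqr_ge0 //.
    have := slow _ (Az0 _ Ap); have := modulus_ge0 (twist w f z0).
    rewrite ler_pdivrMr // => h1 h2.
    rewrite (_ : _ * 4 = (2 * modulus (twist w f (of_plane p))) ^+ 2).
      by rewrite ler_sqr ?nnegrE // (le_trans h1).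
    by ring.
  rewrite ler_expR lerD2l lerN2 ler_sqr ?nnegrE ?modulus_ge0 ?(ltW D0) //.
  by have := modulus_triangle z0 (of_plane p) w; have := Az0 _ Ap; lra.
have AD : A `<=` disk z r.
  move=> p Ap; rewrite /disk /=; have := Az0 _ Ap.
  have := modulus_triangle z0 (of_plane p) z; have := modulus_triangle w z0 z; lra.
have side (c : R) : lebesgue_measure (`[c - a, c + a]%classic : set R) = (d / 32)%:E.
  rewrite lebesgue_measure_itv /= lte_fin ltrBlDr -addrA ltrDl addr_gt0 //.
  by rewrite -EFinD /a; congr EFin; field.
have muA : ((@lebesgue_measure R) \x (@lebesgue_measure R))%E A = ((d / 32) ^+ 2)%:E.
  rewrite product_measure1E; try exact: measurable_itv.
  etransitivity; first exact: (congr2 (fun u v => u * v)%E (side x0) (side y0)).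
  by rewrite -EFinM -expr2.
have := ge0_integral_ge_rect ((@lebesgue_measure R) \x (@lebesgue_measure R))%E
  mA AD m0 (fun p _ => dens0 _) Am.
apply: le_trans; rewrite [X in (_ * X)%E](_ : _ = ((d / 32) ^+ 2)%:E); last exact: muA.
rewrite -EFinM lee_fin dw.
rewrite (_ : m * _ = expR (modulus w ^+ 2) * expR (- D ^+ 2) *
  (2 * d * modulus (twist w f z0)) ^+ 2 / 128 ^+ 2); last first.
  by rewrite /m expRD; field.
rewrite (_ : _ * _ * _ = expR (modulus w ^+ 2) * expR (- D ^+ 2) *
  (D * modulus (twist w f w)) ^+ 2 / 128 ^+ 2); last by field.
have c0 : 0 <= 128 ^- 2 :> R by rewrite invr_ge0 exprn_ge0 // ler0n.
apply: (ler_wpM2r c0); apply: ler_wpM2l; first by rewrite mulr_ge0 ?expR_ge0.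
have Dg0 : 0 <= D * modulus (twist w f w) by rewrite mulr_ge0 ?modulus_ge0 ?(ltW D0).
by rewrite ler_sqr ?nnegrE // (le_trans Dg0).
Qed.

End LocalBound.

Theorem proposition5p2 (R : realType) (r : R) (hr : 1 < r) :
  exists C : R,
    forall (f : Cfield R -> Cfield R), entire f ->
    forall (k : nat) (z : Cfield R),
      ((modulus (f^`(k)%classic z) ^+ 2)%:E <=
       (k`!%:R ^+ 2 * C * expR (modulus z ^+ 2)
          * (1 + modulus z) ^+ (2 * k))%:E
       * disk_integral z r (fun zeta => (
           modulus (f zeta * (expR (- modulus zeta ^+ 2 / 2))%:C) ^+ 2)%R))%E.
Proof.
pose K := (r - 1) ^+ 2 * expR (- (r - 1) ^+ 2) / 128 ^+ 2.
have D0 : 0 < r - 1 by rewrite subr_gt0.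
have K0 : 0 < K by rewrite divr_gt0 // mulr_gt0 ?expR_gt0 // exprn_gt0.
(* [expR 3] pays for the excess of [|w|^2] over [|z|^2] on the circle of radius [s]. *)
exists (expR 3 / K) => f ef k z.
rewrite -/(gauss_density f); have df := entire_derivatives ef.
have zp : 0 < 1 + modulus z by rewrite ltr_pwDl // modulus_ge0.
pose c := k`!%:R ^+ 2 * (expR 3 / K) * expR (modulus z ^+ 2) * (1 + modulus z) ^+ (2 * k).
have c0 : 0 < c.
  by rewrite !mulr_gt0 ?expR_gt0 ?invr_gt0 ?exprn_gt0 // ltr0n fact_gt0.
have local w : modulus (w - z) <= 1 ->
    ((gauss_density f w * K)%:E <= disk_integral z r (gauss_density f))%E.
  move=> wz; apply: (gauss_density_le_integral (df 0%N) D0); lra.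
have I0 : (0 <= disk_integral z r (gauss_density f))%E.
  by apply: integral_ge0 => p _; rewrite lee_fin sqr_ge0.
rewrite -/c; case: (disk_integral _ _ _) I0 local => [J| |] //; last first.
  by move=> _ _; rewrite gt0_muley ?lte_fin // leey.
rewrite lee_fin => J0 local; rewrite -EFinM lee_fin.
pose s := (1 + modulus z)^-1; have s0 : 0 < s by rewrite invr_gt0.
pose M := Num.sqrt (J / K * expR (modulus z ^+ 2 + 3)).
have JK : 0 <= J / K * expR (modulus z ^+ 2 + 3).
  by rewrite mulr_ge0 ?expR_ge0 // divr_ge0 // ltW.
have HM w : modulus (w - z) = s -> modulus (f w) <= M.
  move=> wz; have s1 : s <= 1 by rewrite invf_le1 // lerDl modulus_ge0.
  have wle : modulus w ^+ 2 <= modulus z ^+ 2 + 3.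
    have h : modulus w <= modulus z + s.
      by rewrite -wz -[X in modulus X <= _](subrK z) addrC modulusD.
    rewrite (@le_trans _ _ ((modulus z + s) ^+ 2)) //.
      by rewrite ler_sqr ?nnegrE ?modulus_ge0 // (le_trans _ h) ?modulus_ge0.
    have zs : modulus z * s <= 1.
      by rewrite /s ler_pdivrMr // mul1r lerDr.
    have ss : s * s <= 1 by rewrite mulr_ile1 // ltW.
    rewrite sqrrD expr2; lra.
  rewrite -[leLHS]ger0_norm ?modulus_ge0 // -sqrtr_sqr ler_sqrt //.
  have := local w; rewrite lee_fin wz gauss_densityE => /(_ s1).
  rewrite -ler_pdivlMr // expRN ler_pdivrMr ?expR_gt0 // => /le_trans; apply.
  by rewrite ler_wpM2l ?ler_expR // divr_ge0 // ltW.
have := cauchy_estimate k df s0 HM; rewrite /s exprVn invrK => H.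
have -> : c * J = (k`!%:R * M * (1 + modulus z) ^+ k) ^+ 2.
  rewrite !exprMn sqr_sqrtr // /c [expR (_ + 3)]expRD -exprM mulnC; field.
  by rewrite gt_eqF.
by rewrite ler_sqr ?nnegrE ?modulus_ge0 // (le_trans _ H) ?modulus_ge0.
Qed.
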